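(* Let $\kappa\geq \mathfrak{s}$ be a cardinal number and let $p\in D(2)$. Then $\Sigma(D(2),p,\kappa)$ is not SHD, and its Stone-Čech compactification $\beta\Sigma(D(2),p,\kappa)$ is SHD.
   Context: $D(2)$ is the two-point discrete space $\{0,1\}$ and $D(2)^\kappa$ carries the product topology. For $p\in D(2)$, $\Sigma(D(2),p,\kappa)=\{x\in D(2)^\kappa : |\{\alpha\in\kappa : x(\alpha)\neq p\}|\leq\omega\}$ with the subspace topology. The splitting number $\mathfrak{s}$ is the least cardinality of a family $\mathcal{S}$ of infinite subsets of $\omega$ such that for every infinite $A\subseteq\omega$ there is $S\in\mathcal{S}$ with both $A\cap S$ and $A\setminus S$ infinite. A topological space $Y$ is SHD (selectively highly divergent) if for every sequence $(U_n)_{n\in\omega}$ of non-empty open subsets of $Y$ one can pick $x_n\in U_n$ for each $n\in\omega$ in such a way that the sequence $(x_n)$ has no convergent subsequence in $Y$. *)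

(* Defs.v *)
From HB Require Import structures.
From mathcomp Require Import all_boot all_order all_algebra.
From mathcomp Require Import all_classical all_reals all_analysis.
Import Order.TTheory GRing.Theory Num.Theory numFieldTopology.Exports.

Set Implicit Arguments.
Unset Strict Implicit.
Unset Printing Implicit Defensive.

Local Open Scope classical_set_scope.
Local Open Scope card_scope.
Local Open Scope ring_scope.

(* [bool], with its discrete topology, is D(2); a cardinal is a type [K] up to
   bijection, and [{ptws K -> bool}] carries the product topology. *)
Definition Sigma_product (p : bool) (K : Type) : topologicalType :=
  set_type [set x : {ptws K -> bool} | countable [set a : K | x a <> p]].

Definition splits (S A : set nat) : Prop :=
  infinite_set (A `&` S) /\ infinite_set (A `\` S).

Definition splitting_family (F : set (set nat)) : Prop :=
  (forall S, F S -> infinite_set S) /\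
  (forall A, infinite_set A -> exists2 S, F S & splits S A).

(* The cardinality of such an [F] is the splitting number. *)
Definition least_splitting_family (F : set (set nat)) : Prop :=
  splitting_family F /\ (forall G, splitting_family G -> F #<= G).

Definition splitting_number_le (K : Type) : Prop :=
  exists2 F, least_splitting_family F & F #<= [set: K].

Definition has_convergent_subsequence (Y : topologicalType) (x : nat -> Y) :
    Prop :=
  exists2 phi : nat -> nat, {homo phi : m n / (m < n)%N} &
    exists l : Y, x \o phi @ \oo --> l.

Definition SHD (Y : topologicalType) : Prop :=
  forall U : nat -> set Y,
    (forall n, open (U n)) -> (forall n, U n !=set0) ->
    exists2 x : nat -> Y, (forall n, U n (x n)) &
      ~ has_convergent_subsequence x.

(* The Stone-Cech compactification, as the closure of the canonical image of
   [X] in the cube indexed by all continuous functions from [X] to [0, 1]. *)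
Section stone_cech.
Context (R : realType) (X : topologicalType).

Definition unit_interval : topologicalType := set_type `[0 : R, 1]%classic.

Definition Cunit := set_type [set f : X -> unit_interval | continuous f].

Definition unit_cube : topologicalType :=
  prod_topology (fun _ : Cunit => unit_interval).

Definition stone_cech_eval (x : X) : unit_cube := fun f => set_val f x.

Definition stone_cech : topologicalType :=
  set_type (closure (range stone_cech_eval)).

Lemma stone_cech_unit_subproof (x : X) :
  stone_cech_eval x \in closure (range stone_cech_eval).
Proof. by apply/mem_set/subset_closure; exists x. Qed.

Definition stone_cech_unit (x : X) : stone_cech :=
  @exist unit_cube (fun y => y \in closure (range stone_cech_eval))
    (stone_cech_eval x) (stone_cech_unit_subproof x).

End stone_cech.

Lemma compact_set_typeT (X : topologicalType) (A : set X) : compact A -> compact [set: set_type A].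
Proof.
move=> cA F FF _.
pose G := (@set_val X A) @ F.
have GA : G A.
  by rewrite /G /fmap /=; apply: (@filterS _ _ _ setT) filterT => x _ /=; exact: set_valP.
have [y [Ay cly]] := cA G _ GA.
exists (exist _ y (mem_set Ay)); split => //.
move=> P Q FP [_ [[W oW <-] /= Wy WQ]].
have : (set_val @` P `&` W) !=set0.
  apply: cly; last exact: open_nbhs_nbhs.
  by apply: (@filterS _ F _ P) FP => z Pz /=; exists z.
move=> [_ [[z Pz <-] Wz]]; exists z; split => //; exact: WQ.
Qed.

Lemma hausdorff_set_type (X : topologicalType) (A : set X) : hausdorff_space X -> hausdorff_space (set_type A).
Proof.
move=> hX x y cl; apply: val_inj; apply: hX => P Q Px Qy.
have c := @initial_continuous (set_type A) X set_val.
have [z [Pz Qz]] := cl _ _ (c x _ Px) (c y _ Qy).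
by exists (set_val z).
Qed.

(* [stone_cech R X] is compact Hausdorff, the unit map is continuous with dense
   range and induces the topology of [X] when [X] is completely regular, and
   every continuous map from [X] to [0, 1] extends along it. *)
Section stone_cech_theory.
Context (R : realType) (X : topologicalType).

Lemma unit_cube_hausdorff : hausdorff_space (unit_cube R X).
Proof. apply: hausdorff_product => f; by apply: hausdorff_set_type; exact: Rhausdorff. Qed.

Lemma stone_cech_hausdorff : hausdorff_space (stone_cech R X).
Proof. apply: hausdorff_set_type; exact: unit_cube_hausdorff. Qed.

Lemma unit_cube_compact : compact [set: unit_cube R X].
Proof.
have -> : [set: unit_cube R X] =
    [set f : forall i : Cunit R X, unit_interval R | forall i, [set: unit_interval R] (f i)].
  by apply/seteqP; split.
apply: (@tychonoff (Cunit R X) (fun=> unit_interval R) (fun=> setT)) => _; apply: compact_set_typeT; exact: segment_compact.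
Qed.

Lemma stone_cech_compact : compact [set: stone_cech R X].
Proof.
apply: compact_set_typeT; apply: subclosed_compact unit_cube_compact _ => //.
exact: closed_closure.
Qed.

Lemma stone_cech_eval_continuous : continuous (@stone_cech_eval R X).
Proof.
move=> x; apply/cvg_sup => f; apply/cvg_image.
  by apply/seteqP; split => // z _; exists (fun=> z).
move=> U; rewrite /= => nU.
have := set_valP f; rewrite /= => /(_ x _ nU) h.
exists (fun g : unit_cube R X => U (g f)) => /=; first exact: h.
by apply/seteqP; split => [_ [g Ug <-]//|z Uz]; exists (fun=> z).
Qed.

Lemma stone_cech_unit_continuous : continuous (@stone_cech_unit R X).
Proof.
move=> x U [_ [[W oW <-] /= Wx WU]].
have : nbhs (stone_cech_eval (R:=R) x) W by apply: open_nbhs_nbhs.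
move/(@stone_cech_eval_continuous x) => h; apply: (@filterS _ (nbhs x) _ _ _ _ h) => z Wz; exact: WU.
Qed.

Lemma stone_cech_unit_dense : dense (range (@stone_cech_unit R X)).
Proof.
move=> O [z Oz] [W oW WO].
have := set_valP z; move=> /= /(_ W).
have Wz : W (set_val z) by rewrite -WO in Oz.
case; first by apply: open_nbhs_nbhs.
move=> _ [[x _ <-] Wx]; exists (stone_cech_unit R x); split; last by exists x.
by rewrite -WO.
Qed.

Lemma stone_cech_unit_extend (f : X -> unit_interval R) : continuous f ->
  exists2 g : stone_cech R X -> unit_interval R, continuous g &
    g \o @stone_cech_unit R X = f.
Proof.
move=> cf.
pose F : Cunit R X := exist _ f (mem_set cf).
exists (fun z => set_val z F) => // z.
apply: (@continuous_comp _ _ _ set_val (fun h : unit_cube R X => h F)).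
  exact: initial_continuous.
exact: proj_continuous.
Qed.

Lemma stone_cech_unit_embed (x : X) (U : set X) : completely_regular_space X -> nbhs x U ->
  exists2 V, nbhs (stone_cech_unit R x) V & @stone_cech_unit R X @^-1` V `<=` U.
Proof.
move=> crX; rewrite nbhsE => -[W0 [] oO Ox OU].
have nOx : ~ (~` W0) x by apply.
have [f [cf f01 f0 f1]] := proj1 (uniform_separatorP (R := R) _ _) (crX x _ (open_closedC oO) nOx).
have g01 y : f y \in `[0 : R, 1]%classic by apply/mem_set/f01; exists y.
pose g y : unit_interval R := exist _ (f y) (g01 y).
have cg : continuous g.
  move=> y W [_ [[V oV <-] /= Vy VW]].
  have : nbhs (f y) V by apply: open_nbhs_nbhs.
  by move/cf => h; apply: (@filterS _ (nbhs y) _ _ _ _ h) => z Vz; exact: VW.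
have [h ch hg] := stone_cech_unit_extend cg.
exists (h @^-1` [set t : unit_interval R | set_val t < 1]).
  apply: (ch (stone_cech_unit R x)).
  apply: open_nbhs_nbhs; split.
    by exists [set t : R | t < 1] => //; exact: open_lt.
  rewrite /= -[h _]/((h \o _) x) hg /= set_valE /=.
  by have -> : f x = 0 by apply: f0; exists x.
move=> y /=; rewrite -[h _]/((h \o _) y) hg /= set_valE /= => fy.
apply: OU; apply: contrapT => nOy.
by have f1y : f y = 1 by [apply: f1; exists y]; rewrite f1y ltxx in fy.
Qed.

End stone_cech_theory.

(* Main.v *)
(* Write X for the Sigma-product and bX for its Stone-Cech compactification.
   Both halves rest on a diagonal argument: countably many 0-1 sequences are
   all eventually constant along a common subsequence. Any sequence in X has
   its supports in one countable set of coordinates, so it has a convergent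
   subsequence, and X is not SHD. Conversely, the coordinates extend to bX and,
   by compactness, every nonempty open set of bX contains points whose
   coordinates are prescribed arbitrarily outside a finite set G. Given open
   sets U_n with finite sets G_n, pass to a subsequence e along which none of
   the members of the splitting family indexed by the countable union of the
   G_n splits the range of e; choosing z_n in U_n whose coordinate at S is
   [e n \in S] whenever S is not in G_n, a convergent subsequence of z would
   yield an infinite set split by no member of the family. *)

Require Import Defs.
From mathcomp Require Import all_boot all_order all_algebra.
From mathcomp Require Import all_classical all_reals all_analysis.
Import Order.TTheory GRing.Theory Num.Theory.

Set Implicit Arguments.
Unset Strict Implicit.
Unset Printing Implicit Defensive.

Local Open Scope classical_set_scope.
Local Open Scope card_scope.

(** * Subsequences of 0-1 sequences and splitting *)

Lemma eventually_constant_subsequence (b : nat -> nat -> bool) :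
  exists2 e : nat -> nat, {homo e : m n / (m < n)%N} &
    forall i, exists c, \forall n \near \oo, b i (e n) = c.
Proof.
(* A free ultrafilter selects a limit value [c i] for all rows simultaneously. Finitely many rows
   take their values together on a member of [G], hence at arbitrarily large indices. *)
have [G [UG ooG]] := ultraFilterLemma eventually_filter.
have /choice [c Gc] : forall i, exists c, G [set m | b i m = c].
  move=> i; have [Gb|Gb] := in_ultra_setVsetC [set m | b i m] UG.
    by exists true.
  by exists false; apply: filterS Gb => m /negP/negbTE.
have Gcs n : G [set m | forall i, (i < n)%N -> b i m = c i].
  elim: n => [|n IHn]; first exact: filterS filterT.
  apply: filterS2 IHn (Gc n) => m bm bnm i.
  by rewrite ltnS leq_eqVlt => /predU1P[->//|]; exact: bm.
have /choice [s sP] : forall nm : nat * nat, exists k,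
    (nm.2 < k)%N /\ forall i, (i < nm.1)%N -> b i k = c i.
  move=> [n m].
  have Gm : G [set k | (m < k)%N] by apply: ooG; exact: nbhs_infty_gt.
  by have [k [? ?]] := filter_ex (filterI Gm (Gcs n)); exists k.
(* For positive [n], the index [e n] agrees with [c] on all rows below [n], so row [i] is constant
   from [i.+1] on. *)
pose e := fix e n := if n is n'.+1 then s (n, e n') else 0.
exists e.
  apply: (@homo_ltn _ e (fun m n => (m < n)%N)) => [? ? ?|n].
    exact: ltn_trans.
  by case: (sP (n.+1, e n)).
move=> i; exists (c i); exists i.+1 => // -[//|n] /= lein.
by case: (sP (n.+1, e n)) => _; exact.
Qed.

Lemma increasing_inj (e : nat -> nat) :
  {homo e : m n / (m < n)%N} -> injective e.
Proof.
move=> e_incr m n; case: (ltngtP m n) => // /e_incr /[swap] ->;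
  by rewrite ltnn.
Qed.

Lemma increasing_cvg_infty (e : nat -> nat) :
  {homo e : m n / (m < n)%N} -> e @ \oo --> \oo.
Proof.
move=> e_incr A [N _ NA]; exists N => // n /= Nn; apply: NA; rewrite /=.
apply: leq_trans Nn _; elim: n => // n IHn.
by apply: leq_ltn_trans IHn _; exact: e_incr.
Qed.

(** According to [c], the range of [e] is almost contained in [S] or almost disjoint from it:
    exceptions occur only among the first [N] values. *)
Lemma not_splits_eventually_constant (S : set nat) (e : nat -> nat)
    (b : nat -> bool) (c : bool) :
  {homo e : m n / (m < n)%N} ->
  (forall n, b n <-> S (e n)) ->
  (\forall n \near \oo, b n = c) -> ~ splits S (range e).
Proof.
move=> e_incr bS [N _ Nc] [inS inC].
have fin : finite_set (e @` `I_N) by apply: finite_image; exact: finite_II.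
case: c Nc => Nc; [apply: inC|apply: inS]; apply: sub_finite_set fin.
  move=> _ [[n _ <-] nS]; exists n => //=; rewrite ltnNge; apply/negP => Nn.
  by apply/nS/bS; rewrite Nc.
move=> _ [[n _ <-] nS]; exists n => //=; rewrite ltnNge; apply/negP => Nn.
by move/bS: nS; rewrite Nc.
Qed.

(** * Convergence in the Sigma-product *)

Section Sigma.
Variables (p : bool) (K : Type).
Local Notation X := (Sigma_product p K).

Lemma Sigma_product_cvg (F : set_system X) (x : X) : Filter F ->
  (forall a, \forall y \near F, set_val y a = set_val x a) -> F --> x.
Proof.
move=> FF Fx A [_ [[W oW <-] Wx WA]]; apply: filterS WA _.
have : set_val @ F --> (set_val x : {ptws K -> bool}).
  apply/cvg_sup => a; apply/cvg_image.
    by apply/seteqP; split => // c _; exists (fun=> c).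
  move=> U /nbhs_singleton Ux.
  exists [set y : {ptws K -> bool} | U (y a)].
    by apply: filterS (Fx a) => y; rewrite /= => ->.
  by apply/seteqP; split => [_ [y Uy <-]//|c Uc]; exists (fun=> c).
by apply; apply: open_nbhs_nbhs.
Qed.

Lemma Sigma_product_coord (a : K) (x : X) :
  \forall y \near x, set_val y a = set_val x a.
Proof.
have cx : {for x, continuous (fun y : X => (set_val y : {ptws K -> bool}) a)}.
  apply: (@continuous_comp _ _ _ set_val (fun y : {ptws K -> bool} => y a)).
    exact: initial_continuous.
  exact: (@proj_continuous {classic K} (fun=> bool) a).
apply: (cx [set c | c = set_val x a]); exact: discrete_set1.
Qed.

Lemma countable_support (x : X) : countable [set a | set_val x a <> p].
Proof. exact: (set_valP x). Qed.

Lemma Sigma_product_of (y : K -> bool) : countable [set a | y a <> p] ->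
  exists x : X, set_val x = y.
Proof. by move=> cy; exists (exist _ y (mem_set cy)). Qed.

Lemma not_SHD_Sigma_product : ~ SHD X.
Proof.
have [x0 _] : exists x : X, set_val x = (fun=> p : bool).
  apply: Sigma_product_of; have -> : [set a : K | p <> p] = set0.
    by apply/seteqP; split.
  exact: countable0.
case/(_ (fun=> setT)) => [_|_|x _]; [exact: openT|by exists x0|].
apply.
have /countable_injP [f injf] :
    countable (\bigcup_n [set a | set_val (x n) a <> p]).
  by apply: bigcup_countable => // n _; exact: countable_support.
set C := \bigcup_n _ in injf.
(* Row [f a] lists the values at the coordinate [a] of [C]; a row whose index codes no coordinate is
   constantly [false]. *)
have [e e_incr eP] := eventually_constant_subsequence
  (fun i n => `[< exists2 a, C a & f a = i /\ set_val (x n) a >]).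
(* The second clause keeps the support of the limit inside [C], so that the limit stays in the
   Sigma-product. *)
have /choice [l lP] : forall a, exists c,
    (\forall n \near \oo, set_val (x (e n)) a = c) /\ (~ C a -> c = p).
  move=> a; have [Ca|nCa] := pselect (C a).
    have [c cP] := eP (f a); exists c; split=> //.
    apply: filterS cP => n <-; apply/idP/asboolP => [xa|[a' Ca' [/injf <-]//]].
    - by exists a.
    - exact: mem_set.
    - exact: mem_set.
  exists p; split => //; exists 0 => // n _.
  by apply: contrapT => xa; apply: nCa; exists (e n).
have [z zl] : exists z : X, set_val z = l.
  apply: Sigma_product_of; apply: (@sub_countable _ _ _ C); last first.
    by apply/countable_injP; exists f.
  apply: subset_card_le => a /= la; apply: contrapT => nCa.
  by apply: la; case: (lP a) => _; apply.
exists e => //; exists z; apply: Sigma_product_cvg => a.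
by rewrite zl; case: (lP a) => + _; exact.
Qed.

End Sigma.

(** * Approximating arbitrary points of the full product *)

Section cylinders.
Variables (p : bool) (K : Type).
Local Notation X := (Sigma_product p K).

(* The trace on X of the neighbourhoods of [y] in the full product, where [y]
   itself need not lie in X. *)
Definition cylinders (y : K -> bool) : set_system X :=
  filter_from finite_set
    (fun G => [set x : X | forall a, G a -> set_val x a = y a]).

(** Properness is the density of X in the full product: [y] on a finite [G], continued by [p], has
    finite support. *)
Lemma cylinders_filter (y : K -> bool) : ProperFilter (cylinders y).
Proof.
apply: filter_from_proper; first apply: filter_from_filter.
- by exists set0.
- move=> G H finG finH; exists (G `|` H); first by rewrite finite_setU.
  by move=> x xy; split => a ?; apply: xy; [left|right].
move=> G finG.
have [] := @Sigma_product_of p K (fun a => if a \in G then y a else p).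
  apply: (@sub_countable _ _ _ G); last exact: finite_set_countable.
  apply: subset_card_le => a /=; by case: ifPn => // /set_mem.
by move=> x xE; exists x => a Ga; rewrite xE mem_set.
Qed.

Lemma cylinders_coord (y : K -> bool) (a : K) :
  \forall x \near cylinders y, set_val x a = y a.
Proof. by exists [set a] => [|x]; [exact: finite_set1|exact]. Qed.

Lemma cvg_cylinders (x : X) : cylinders (set_val x) --> x.
Proof.
have := cylinders_filter (set_val x) => ?.
by apply: Sigma_product_cvg => a; exact: cylinders_coord.
Qed.

End cylinders.

(** * Coordinates on the Stone-Cech compactification *)

Section stone_cech_Sigma.
Variables (R : realType) (p : bool) (K : Type).
Local Notation X := (Sigma_product p K).
Local Notation bX := (stone_cech R X).

Lemma bit_subproof (b : bool) : (b%:R : R)%R \in `[0%R, 1%R]%classic.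
Proof. by apply: mem_set; rewrite /= in_itv/= ler0n lern1 leq_b1. Qed.

(** The extension property concerns maps into the unit interval, so D(2) is embedded as its
    endpoints. *)
Definition bit (b : bool) : unit_interval R :=
  exist _ (b%:R)%R (bit_subproof b).

Lemma bit_inj : injective bit.
Proof.
move=> [] [] // /(congr1 (@set_val _ _)) /eqP; rewrite !set_valE /=.
  by rewrite oner_eq0.
by rewrite eq_sym oner_eq0.
Qed.

Lemma unit_interval_hausdorff : hausdorff_space (unit_interval R).
Proof. by apply: hausdorff_set_type; exact: Rhausdorff. Qed.

Lemma stone_cech_coordinates : exists g : K -> bX -> unit_interval R,
  (forall a, continuous (g a)) /\
  forall a x, g a (stone_cech_unit R x) = bit (set_val x a).
Proof.
have /choice [g gP] : forall a, exists g : bX -> unit_interval R,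
    continuous g /\ forall x, g (stone_cech_unit R x) = bit (set_val x a).
  move=> a; have [|g cg gE] :=
    @stone_cech_unit_extend R X (fun x => bit (set_val x a)).
    move=> x U /nbhs_singleton Ux.
    apply: (@filterS _ (nbhs x) _ _ _ _ (Sigma_product_coord a x)) => y /=.
    by move=> ->.
  by exists g; split => // x; rewrite -[LHS]/((g \o _) x) gE.
by exists g; split => a; [case: (gP a)|move=> x; case: (gP a)].
Qed.

Lemma stone_cech_open_coordinates (g : K -> bX -> unit_interval R)
    (U : set bX) :
  (forall a, continuous (g a)) ->
  (forall a x, g a (stone_cech_unit R x) = bit (set_val x a)) ->
  open U -> U !=set0 ->
  exists (G : set K) (s : K -> bool), finite_set G /\
    forall y : K -> bool, (forall a, G a -> y a = s a) ->
    exists2 z, U z & forall a, g a z = bit (y a).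
Proof.
move=> cg gE oU [z0 Uz0].
have nU : nbhs z0 U by apply: open_nbhs_nbhs.
(* Shrinking to [closure W] inside [U] is needed because a cluster point of a filter living on [W]
   may leave [W]. *)
have [W nW WU] := compact_regular (@stone_cech_hausdorff R X)
  (@stone_cech_compact R X) filterT nU.
have [x1 [Wx0 [x0 _ x0E]]] : (W° `&` range (@stone_cech_unit R X)) !=set0.
  by apply: stone_cech_unit_dense; [exists z0|exact: open_interior].
rewrite -x0E in Wx0.
have : nbhs x0 (@stone_cech_unit R X @^-1` W).
  exact: (@stone_cech_unit_continuous R X x0 _ Wx0).
move=> /cvg_cylinders [G finG GW].
exists G, (set_val x0); split=> // y yx0.
have := @cylinders_filter p K y => cyl.
pose F := @stone_cech_unit R X @ @cylinders p K y.
(* The witness is a cluster point of [F]: it lies in [closure W] and has the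
   coordinates of [y]. *)
have FW : F (closure W).
  exists G => // x xy; apply: subset_closure; apply: GW => a Ga.
  by rewrite xy// yx0.
have [z [_ clz]] := @stone_cech_compact R X F _ filterT.
exists z.
  by apply: WU; apply: (@closed_closure _ W) => V nV; exact: clz.
move=> a; apply: unit_interval_hausdorff => P Q Pz Qy.
have [||t [/= tE Pt]] := clz [set t | g a t = bit (y a)] (g a @^-1` P).
- exists [set a] => [|x /(_ a erefl) xy]; first exact: finite_set1.
  by rewrite /= gE xy.
- exact: cg.
by exists (g a t); split => //; rewrite tE; exact: nbhs_singleton.
Qed.

(** Otherwise both values recur infinitely often, and [l] would equal both endpoints. *)
Lemma cvg_bit (u : nat -> unit_interval R) (b : nat -> bool)
    (l : unit_interval R) :
  (forall n, u n = bit (b n)) -> u @ \oo --> l ->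
  exists c, \forall n \near \oo, b n = c.
Proof.
move=> ub ul; apply: contrapT => nc.
have bl c : l = bit c.
  apply: unit_interval_hausdorff => P Q Pl Qc; apply: contrapT => PQ.
  have Pu : \forall n \near \oo, P (u n) by exact: ul.
  apply: nc; exists (~~ c); apply: filterS Pu => n Pn.
  have [bc|] := eqVneq (b n) c; last by case: (b n) (c) => [] [].
  case: PQ; exists (u n); split => //; rewrite ub bc.
  exact: nbhs_singleton.
by have := bit_inj (etrans (esym (bl true)) (bl false)).
Qed.

Lemma SHD_stone_cech_Sigma_product (F : set (set nat)) :
  splitting_family F -> F #<= [set: K] -> SHD bX.
Proof.
move=> [_ splitF] FK U oU U0.
have [r r_inj] : exists r : set_type F -> K, injective r.
  have /unsquash f := card_leP FK.
  by exists (set_val \o f) => S T /val_inj; apply: inj; exact: mem_set.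
have [g [cg gE]] := stone_cech_coordinates.
have /choice [G /choice [s Gs]] := fun n =>
  stone_cech_open_coordinates cg gE (oU n) (U0 n).
have /countable_injP [f f_inj] : countable (\bigcup_n G n).
  apply: bigcup_countable => // n _.
  by apply: finite_set_countable; case: (Gs n).
have [e e_incr eP] := eventually_constant_subsequence (fun i m =>
  `[< exists S : set_type F,
        [/\ (\bigcup_n G n) (r S), f (r S) = i & set_val S m] >]).
(* Outside [G n], the coordinate [r S] records whether [e n] lies in [S]; coordinates outside the
   range of [r] get [false]. *)
pose y n a := if a \in G n then s n a
  else `[< exists2 S : set_type F, r S = a & set_val S (e n) >].
have /choice [z zP] : forall n, exists z,
    U n z /\ forall a, g a z = bit (y n a).
  move=> n; have [_ /(_ (y n))] := Gs n.
  case=> [a Ga|z]; first by rewrite /y mem_set.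
  by exists z.
exists z => [n|[phi phi_incr [l zl]]]; first by case: (zP n).
have ephi_incr : {homo e \o phi : m n / (m < n)%N}.
  by move=> m n mn; apply: e_incr; exact: phi_incr.
have [S0 FS0 splitS] : exists2 S, F S & splits S (range (e \o phi)).
  apply: splitF => /finite_preimage-/(_ _ (e \o phi)); rewrite preimage_range.
  apply: contra_not infinite_nat; apply=> m n _ _.
  exact: (increasing_inj ephi_incr).
pose S : set_type F := exist _ S0 (mem_set FS0).
(* If some [G n] contains [r S], membership already stabilises along [e]. If none does, [r S]
   carries the membership bit at every [n], and convergence of [z \o phi] stabilises it. *)
have [c Sc] : exists c, \forall n \near \oo, `[< S0 (e (phi n)) >] = c.
  have [GS|nGS] := pselect ((\bigcup_n G n) (r S)).
    have [c cP] := eP (f (r S)); exists c.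
    have phi_oo : phi @ \oo --> \oo by exact: increasing_cvg_infty.
    apply: (@filterS _ \oo _ _ _ _ (phi_oo _ cP)) => n /= <-.
    apply/asboolP/asboolP => [Sn|].
      by exists S.
    by move=> [T [GT /f_inj-/(_ (mem_set GT) (mem_set GS)) /r_inj ->]].
  have gzl : g (r S) (z (phi n)) @[n --> \oo] --> g (r S) l.
    exact: (cvg_comp (z \o phi) (g (r S)) zl (cg (r S) l)).
  have [c cP] := cvg_bit (fun n => (zP (phi n)).2 (r S)) gzl.
  exists c; apply: filterS cP => n <-; rewrite /y ifN.
    apply/asboolP/asboolP => [Sn|[T /r_inj -> //]].
    by exists S.
  by apply/negP => /set_mem GS; apply: nGS; exists (phi n).
apply: (not_splits_eventually_constant ephi_incr _ Sc) splitS => n.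
by split => /asboolP.
Qed.

End stone_cech_Sigma.

Unset Implicit Arguments.

Theorem corollary3 (R : realType) (K : Type) (p : bool)
    (hK : splitting_number_le K) :
  ~ SHD (Sigma_product p K) /\ SHD (stone_cech R (Sigma_product p K)).
Proof.
split; first exact: not_SHD_Sigma_product.
by case: hK => F [splitF _] FK; exact: SHD_stone_cech_Sigma_product splitF FK.
Qed.
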